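(* Let $\mathbb{F}_q$ be a finite field, let $0<i<n$ be integers, and let $t_1(x)=x^n-ax^i-b$ and $t_2(x)=x^n-a'x^{n-i}-b'$ be trinomials over $\mathbb{F}_q$ with $a,b,a',b'\in\mathbb{F}_q\setminus\{0\}$ such that $t_2(x)=t_1(0)^{-1}t_1^*(x)$, where $t_1^*$ is the reciprocal polynomial of $t_1$. Let $S_1$ be the set of all polycyclic codes of length $n$ over $\mathbb{F}_q$ associated with $t_1(x)$, and let $S_2$ be the set of all polycyclic codes of length $n$ over $\mathbb{F}_q$ associated with $t_2(x)$. Then $S_1$ and $S_2$ are in a one-to-one correspondence in which corresponding codes are equivalent: there is a bijection $\varphi:S_1\to S_2$ such that $C$ is equivalent to $\varphi(C)$ for every $C\in S_1$.
   Context: Vectors $(c_0,\dots,c_{n-1})\in\mathbb{F}_q^n$ are identified with polynomials $c_0+c_1x+\cdots+c_{n-1}x^{n-1}$. For a monic polynomial $f(x)\in\mathbb{F}_q[x]$ of degree $n$, a linear code $C\subseteq\mathbb{F}_q^n$ is a polycyclic code associated with $f(x)$ if, under this identification, it is an ideal of $\mathbb{F}_q[x]/\langle f(x)\rangle$ (elements being represented by their remainders of degree less than $n$). The reciprocal polynomial of a polynomial $g(x)$ of degree $k$ is $g^*(x)=x^k g(1/x)$. Two linear codes $C_1,C_2$ of length $n$ over $\mathbb{F}_q$ are equivalent if there is a monomial $n\times n$ matrix $M$ over $\mathbb{F}_q$ (exactly one non-zero entry in each row and each column) with $C_2=\{cM: c\in C_1\}$. *)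

(* Defs.v *)
From mathcomp Require Import all_boot all_algebra all_field.

Set Implicit Arguments.
Unset Strict Implicit.
Unset Printing Implicit Defensive.

Import GRing.Theory.
Local Open Scope ring_scope.

(* Unlike [idealr_closed] of ring_quotient, the unit ideal is allowed:
   the whole space F^n is a polycyclic code. *)
Definition is_ideal (R : finComNzRingType) (I : {set R}) : bool :=
  [&& 0 \in I,
      [forall u in I, forall v in I, u + v \in I]
    & [forall r, forall u in I, r * u \in I]].

(* A linear code of length n over F is a subspace of 'rV[F]_n.  The word
   c_0 ... c_(n-1) is identified with the class, modulo f, of
   rVpoly c = c_0 + c_1 X + ... + c_(n-1) X^(n-1).
   {poly %/ f} is F[X]/<f> only for f monic and nonconstant. *)
Definition polycyclic (F : finFieldType) (n : nat) (f : {poly F})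
    (C : {vspace 'rV[F]_n}) : bool :=
  [&& f \is monic, size f == n.+1
    & is_ideal [set in_qpoly f (rVpoly c) | c in C]].

(* X^k g(1/X) expanded, with k = (size g).-1 the degree of g. *)
Definition reciprocal (F : fieldType) (g : {poly F}) : {poly F} :=
  \sum_(j < size g) g`_j *: 'X^((size g).-1 - j).

Definition monomial_mx (F : fieldType) (n : nat) (M : 'M[F]_n) : bool :=
  [forall i, #|[set j | M i j != 0]| == 1%N] &&
  [forall j, #|[set i | M i j != 0]| == 1%N].

Definition code_equiv (F : fieldType) (n : nat) (C1 C2 : {vspace 'rV[F]_n}) :
    Prop :=
  exists2 M : 'M[F]_n, monomial_mx M &
    forall v : 'rV[F]_n, v \in C2 <-> exists2 c, c \in C1 & v = c *m M.

(* Main.v *)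
(* Reversing the words of length n is a monomial equivalence.  If f(0) is
   nonzero then X is invertible modulo f, so a polycyclic code C contains, with
   c, the word d such that X d = c modulo f.  Degrees force X d - c = k f with k
   a constant, and substituting 1/X turns this into
   d^r - X c^r = k f(0) g, where c^r is the reversal of c and g = f(0)^-1 f^*.
   Hence the reversed code is stable under multiplication by X modulo g. *)
Require Import Defs.
From mathcomp Require Import all_boot all_algebra all_field.

Set Implicit Arguments.
Unset Strict Implicit.
Unset Printing Implicit Defensive.

Import GRing.Theory.
Local Open Scope ring_scope.

Definition rev_mx (F : fieldType) (n : nat) : 'M[F]_n :=
  \matrix_(i, j) (i == rev_ord j)%:R.

Lemma mul_rev_mx (F : fieldType) (n : nat) (c : 'rV[F]_n) (j : 'I_n) :
  (c *m rev_mx F n) 0 j = c 0 (rev_ord j).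
Proof.
rewrite mxE (bigD1 (rev_ord j)) //= mxE eqxx mulr1 big1 ?addr0 //.
by move=> k /negPf nk; rewrite mxE nk mulr0.
Qed.

Lemma rev_mxK (F : fieldType) (n : nat) : rev_mx F n *m rev_mx F n = 1%:M.
Proof.
apply/row_matrixP => i; rewrite row_mul; apply/rowP => j.
by rewrite mul_rev_mx !mxE rev_ordK.
Qed.

Lemma rev_mx_monomial (F : fieldType) (n : nat) : monomial_mx (rev_mx F n).
Proof.
have bool_neq0 (x : bool) : (x%:R != 0 :> F) = x.
  by case: x; rewrite ?oner_eq0 ?eqxx.
apply/andP; split; apply/forallP => i; apply/cards1P; exists (rev_ord i);
  apply/setP => j; rewrite !inE mxE bool_neq0 //.
by rewrite -(inj_eq rev_ord_inj) rev_ordK eq_sym.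
Qed.

Definition rev_code (F : fieldType) (n : nat) (C : {vspace 'rV[F]_n}) :
  {vspace 'rV[F]_n} := (linfun (mulmxr (rev_mx F n)) @: C)%VS.

Lemma mem_rev_code (F : fieldType) (n : nat) (C : {vspace 'rV[F]_n})
    (v : 'rV[F]_n) :
  (v \in rev_code C) = (v *m rev_mx F n \in C).
Proof.
apply/memv_imgP/idP => [[c cC ->]|vC].
  by rewrite lfunE /= -mulmxA rev_mxK mulmx1.
by exists (v *m rev_mx F n); rewrite // lfunE /= -mulmxA rev_mxK mulmx1.
Qed.

Lemma rev_codeK (F : fieldType) (n : nat) : involutive (@rev_code F n).
Proof.
by move=> C; apply/vspaceP => v; rewrite !mem_rev_code -mulmxA rev_mxK mulmx1.
Qed.

Lemma code_equiv_rev (F : fieldType) (n : nat) (C : {vspace 'rV[F]_n}) :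
  code_equiv C (rev_code C).
Proof.
exists (rev_mx F n); first exact: rev_mx_monomial.
move=> v; rewrite mem_rev_code; split=> [vC|[c cC ->]].
  by exists (v *m rev_mx F n); rewrite // -mulmxA rev_mxK mulmx1.
by rewrite -mulmxA rev_mxK mulmx1.
Qed.

(** [in_qpoly f] reduces modulo [mk_monic f], which is [f] itself once [f] is monic and nonconstant.
    Ideal conditions thus become divisibility conditions in F[X]. *)
Lemma in_qpoly_eqP (F : fieldType) (f p q : {poly F}) :
  f \is monic -> (1 < size f)%N ->
  reflect (in_qpoly f p = in_qpoly f q) (f %| p - q).
Proof.
move=> f_monic f_gt1.
have fE : mk_monic f = f by rewrite /mk_monic f_gt1 f_monic.
have -> : (f %| p - q) = (in_qpoly f p - in_qpoly f q == 0).
  by rewrite -raddfB -val_eqE /= fE Pdiv.Idomain.dvdpE.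
by rewrite subr_eq0; apply: eqP.
Qed.

Lemma reciprocalE (F : fieldType) (f : {poly F}) :
  reciprocal f = \poly_(j < size f) f`_((size f).-1 - j).
Proof.
rewrite poly_def /reciprocal (reindex_inj rev_ord_inj) /=.
apply: eq_bigr => -[j /= lt_j] _.
by case: (size f) lt_j => // m lt_j; rewrite subSS /= subKn.
Qed.

(** The scalar makes the reciprocal monic when f(0) is nonzero, since f(0) is then its leading
    coefficient. For f = t1 this is t2. *)
Definition monic_reciprocal (F : fieldType) (f : {poly F}) : {poly F} :=
  f.[0]^-1 *: reciprocal f.

Section MonicReciprocal.

Variables (F : fieldType) (f : {poly F}).
Hypothesis f0 : f.[0] != 0.

Lemma coef_monic_reciprocal j : (j < size f)%N ->
  (monic_reciprocal f)`_j = f.[0]^-1 * f`_((size f).-1 - j).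
Proof. by move=> lt_j; rewrite coefZ reciprocalE coef_poly lt_j. Qed.

Lemma size_monic_reciprocal : size (monic_reciprocal f) = size f.
Proof.
rewrite size_scale ?invr_eq0 // reciprocalE size_poly_eq // subnn.
by rewrite -horner_coef0.
Qed.

Let f_gt0 : (0 < size f)%N.
Proof.
by rewrite size_poly_gt0; apply: contraNneq f0 => ->; rewrite horner0.
Qed.

Lemma monic_reciprocal_monic : monic_reciprocal f \is monic.
Proof.
rewrite monicE lead_coefE size_monic_reciprocal coef_monic_reciprocal.
  by rewrite subnn -horner_coef0 mulVf.
by rewrite prednK.
Qed.

Lemma horner0_monic_reciprocal :
  f \is monic -> (monic_reciprocal f).[0] = f.[0]^-1.
Proof.
move=> /monicP; rewrite lead_coefE => f_lead.
by rewrite horner_coef0 coef_monic_reciprocal // subn0 f_lead mulr1.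
Qed.

End MonicReciprocal.

(** As f(0) is nonzero the degree is kept, so both reversals use the same degree. As f is monic the
    second scalar is f(0), which cancels the first. *)
Lemma monic_reciprocalK (F : fieldType) (f : {poly F}) :
  f \is monic -> f.[0] != 0 -> monic_reciprocal (monic_reciprocal f) = f.
Proof.
move=> f_monic f0; have g0 := horner0_monic_reciprocal f0 f_monic.
have gN0 : (monic_reciprocal f).[0] != 0 by rewrite g0 invr_eq0.
apply/polyP => j; case: (ltnP j (size f)) => [lt_j|le_j]; last first.
  by rewrite !nth_default ?size_monic_reciprocal.
rewrite coef_monic_reciprocal ?size_monic_reciprocal // g0 invrK.
rewrite coef_monic_reciprocal //; last first.
  by case: (size f) lt_j => // m _; rewrite ltnS leq_subr.
by rewrite mulVKf // subKn //; case: (size f) lt_j.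
Qed.

Section Polycyclic.

Variables (F : finFieldType) (m : nat).
Notation n := m.+1.
Implicit Types (f : {poly F}) (C : {vspace 'rV[F]_n}).

(** Zero and sums come from the linearity of [C], so only absorption of products remains. The word
    [d] is the remainder of p c modulo f. *)
Lemma polycyclicP f C : f \is monic -> size f = n.+1 ->
  reflect (forall p c, c \in C ->
             exists2 d, d \in C & f %| rVpoly d - p * rVpoly c)
          (polycyclic f C).
Proof.
move=> f_monic f_size; rewrite /polycyclic f_monic f_size eqxx /=.
have f_gt1 : (1 < size f)%N by rewrite f_size.
set I := [set _ | c in C].
have memI c : c \in C -> in_qpoly f (rVpoly c) \in I.
  by move=> cC; apply/imsetP; exists c.
apply: (iffP idP) => [/and3P[_ _ /forallP mulI] p c cC|mulC].
  have /forall_inP/(_ _ (memI c cC))/imsetP[d dC eq_d] := mulI (in_qpoly f p).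
  by exists d => //; apply/in_qpoly_eqP; rewrite // -eq_d in_qpolyM.
apply/and3P; split.
- by have := memI _ (mem0v C); rewrite !linear0.
- apply/forall_inP => _ /imsetP[c cC ->].
  apply/forall_inP => _ /imsetP[d dC ->].
  by rewrite -!raddfD memI // memvD.
apply/forallP => r; apply/forall_inP => _ /imsetP[c cC ->].
(* Every class is that of its own reduced representative. *)
have rE : in_qpoly f r = r by apply/val_inj/in_qpoly_small/size_mk_monic.
have [d dC /(in_qpoly_eqP _ _ f_monic f_gt1) eq_d] := mulC r c cC.
by rewrite -rE -in_qpolyM -eq_d memI.
Qed.

(** Horner induction on the multiplier: if d represents p c and e represents X d, then e + k c
    represents (p X + k) c. *)
Lemma polycyclic_mulX f C : f \is monic -> size f = n.+1 ->
  (forall c, c \in C -> exists2 d, d \in C & f %| rVpoly d - 'X * rVpoly c) ->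
  polycyclic f C.
Proof.
move=> f_monic f_size mulX; apply/polycyclicP => // p c cC.
elim/poly_ind: p => [|p k [d dC fd]].
  by exists 0; rewrite ?mem0v // linear0 mul0r subrr dvdp0.
have [e eC fe] := mulX d dC.
exists (e + k *: c); first by rewrite memvD ?memvZ.
have -> : rVpoly (e + k *: c) - (p * 'X + k%:P) * rVpoly c =
    rVpoly e - 'X * rVpoly d + 'X * (rVpoly d - p * rVpoly c).
  rewrite linearD linearZ /= -mul_polyC mulrDl mulrBr opprD.
  by rewrite addrACA subrr addr0 -[p * 'X]mulrC mulrA addrA subrK.
by rewrite dvdp_add // dvdp_mull.
Qed.

Lemma polycyclic_divX f C c : f.[0] != 0 -> polycyclic f C -> c \in C ->
  exists2 d, d \in C & exists k, 'X * rVpoly d - rVpoly c = k *: f.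
Proof.
move=> f0 fC cC; have /and3P[f_monic /eqP f_size _] := fC.
(* Zero is not a root of f, so X is coprime to f, and the Bezout coefficient [u] inverts X modulo
   f. *)
have /Bezout_eq1_coprimepP[[u v] /= uv] : coprimep 'X f.
  by rewrite coprimep_sym -['X]subr0 -polyC0 coprimep_XsubC.
have [d dC fd] := polycyclicP C f_monic f_size fC u c cC.
exists d => //.
have /dvdpP[q eq_q] : f %| 'X * rVpoly d - rVpoly c.
  have -> : 'X * rVpoly d - rVpoly c =
      'X * (rVpoly d - u * rVpoly c) - v * rVpoly c * f.
    rewrite mulrBr -addrA -opprD; congr (_ - _).
    by rewrite -[LHS]mul1r -uv mulrDl mulrA ['X * u]mulrC [v * f * _]mulrAC.
  by rewrite dvdp_sub // ?dvdp_mull.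
(* X d - c has degree at most n, the degree of the monic f, so the quotient is constant. *)
have size_q : (size q <= 1)%N.
  have [->|qN0] := eqVneq q 0; first by rewrite size_poly0.
  have : (size (q * f)%R <= n.+1)%N.
    rewrite -eq_q (leq_trans (size_polyD _ _)) // size_polyN geq_max.
    rewrite (leq_trans (size_polyMleq _ _)) ?size_polyX ?ltnS ?size_poly //.
    by rewrite leqW ?size_poly.
  by rewrite size_Mmonic // f_size addnS /= -[m.+2]add1n leq_add2r.
by exists q`_0; rewrite eq_q [q in LHS]size1_polyC // mul_polyC.
Qed.

(** The guard matters: for j >= n the truncated [m - j] is 0 and would pick the constant
    coefficient. *)
Lemma coef_rVpoly_rev (c : 'rV[F]_n) j :
  (rVpoly (c *m rev_mx F n))`_j = if (j < n)%N then (rVpoly c)`_(m - j) else 0.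
Proof.
case: ltnP => [lt_j|le_j]; last first.
  by rewrite nth_default // (leq_trans _ le_j) ?size_poly.
rewrite -[j]/(val (Ordinal lt_j)) coef_rVpoly_ord mul_rev_mx -coef_rVpoly_ord.
by rewrite /= subSS.
Qed.

Lemma polycyclic_rev f C : f.[0] != 0 -> polycyclic f C ->
  polycyclic (monic_reciprocal f) (rev_code C).
Proof.
move=> f0 fC; have /and3P[f_monic /eqP f_size _] := fC.
apply: polycyclic_mulX;
  rewrite ?monic_reciprocal_monic ?size_monic_reciprocal //.
move=> c; rewrite mem_rev_code => /(polycyclic_divX f0 fC)[d dC [k eq_k]].
(* Here [c] lies in the reversed code, and [d] satisfies X d - c^r = k f with c^r the reversal of
   [c]; the witness is the reversal of [d]. *)
exists (d *m rev_mx F n); first by rewrite mem_rev_code -mulmxA rev_mxK mulmx1.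
suff -> : rVpoly (d *m rev_mx F n) - 'X * rVpoly c =
    (k * f.[0]) *: monic_reciprocal f by rewrite -mul_polyC dvdp_mull.
apply/polyP => j; rewrite coefZ coefB coefXM coef_rVpoly_rev.
case: (ltnP j n.+1) => [lt_j|le_j]; last first.
  rewrite [X in _ = _ * X]nth_default ?size_monic_reciprocal ?f_size // mulr0.
  rewrite ltnNge (ltnW le_j) /= sub0r.
  case: j le_j => // j le_j.
  by rewrite /= nth_default ?oppr0 // (leq_trans (size_poly _ _)).
rewrite coef_monic_reciprocal // ?f_size // -mulrA mulVKf //.
(* Substituting 1/X is done on coefficients: coefficient j of the goal is coefficient n - j of this
   identity. *)
have := congr1 (fun p : {poly F} => p`_(n - j)) eq_k.
rewrite coefZ coefB coefXM coef_rVpoly_rev => <-.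
(* For j = 0 the reversed word has no coefficient n. For a successor j + 1, both terms in [d] vanish
   exactly at j + 1 = n, where m - j = 0. *)
case: j lt_j => [|j lt_j]; first by rewrite !subn0 ltnn.
rewrite subSS !ltnS leq_subr subKn // subn_eq0.
by case: ltnP => _; rewrite // subnS.
Qed.

Lemma rev_polycyclic f C : f \is monic -> f.[0] != 0 ->
  polycyclic (monic_reciprocal f) C -> polycyclic f (rev_code C).
Proof.
move=> f_monic f0 /polycyclic_rev; rewrite monic_reciprocalK //; apply.
by rewrite horner0_monic_reciprocal // invr_eq0.
Qed.

End Polycyclic.

Theorem theorem3p3 (F : finFieldType) (n i : nat) (hi0 : (0 < i)%N)
    (hin : (i < n)%N) (a b a' b' : F)
    (ha : a != 0) (hb : b != 0) (ha' : a' != 0) (hb' : b' != 0)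
    (t1 t2 : {poly F})
    (ht1 : t1 = 'X^n - a *: 'X^i - b%:P)
    (ht2 : t2 = 'X^n - a' *: 'X^(n - i) - b'%:P)
    (ht12 : t2 = (t1.[0])^-1 *: reciprocal t1) :
  exists phi : {C : {vspace 'rV[F]_n} | polycyclic t1 C} ->
               {C : {vspace 'rV[F]_n} | polycyclic t2 C},
    bijective phi /\ forall C, code_equiv (sval C) (sval (phi C)).
Proof.
case: n hin ht1 ht2 ht12 => // m lt_im ht1 _ t2E.
have t1E : t1 = 'X^(m.+1) - (a *: 'X^i + b%:P) by rewrite ht1 opprD addrA.
(* Since i < n, the lower terms do not affect the leading term X^n. *)
have size_low : (size (a *: 'X^i + b%:P)%R < m.+2)%N.
  rewrite ltnS (leq_trans (size_polyD _ _)) // geq_max.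
  rewrite size_scale // size_polyXn lt_im.
  by rewrite (leq_trans (size_polyC_leq1 _)) // (leq_trans _ lt_im).
have t1_monic : t1 \is monic.
  by rewrite t1E monicE lead_coefDl ?lead_coefXn // size_polyN size_polyXn.
(* As i > 0, the value at 0 is -b. *)
have t10 : t1.[0] != 0.
  rewrite ht1 !hornerE !expr0n (gtn_eqF hi0) /=.
  by rewrite mulr0 subr0 sub0r oppr_eq0.
have fwd C : polycyclic t1 C -> polycyclic t2 (@rev_code F m.+1 C).
  by rewrite t2E; apply: polycyclic_rev.
have bwd C : polycyclic t2 C -> polycyclic t1 (@rev_code F m.+1 C).
  by rewrite t2E; apply: rev_polycyclic.
(* Reversal serves in both directions; the membership proofs are boolean, so comparing the
   underlying codes suffices. *)
exists (fun C => exist _ (rev_code (sval C)) (fwd _ (svalP C))); split.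
  exists (fun C => exist _ (rev_code (sval C)) (bwd _ (svalP C))) => C;
    by apply: val_inj; rewrite /= rev_codeK.
by move=> C; apply: code_equiv_rev.
Qed.
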